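(* Let $I=[0,1]$ with Lebesgue measure $m$, and $(I^{\infty},m^{\infty})$ the product space. Let $\mathfrak{M}=\{\{t_n\}_{n\ge1}: t_n\in\{1,\dots,n\}\}$ with the product measure $\mu=\prod_n\mu_n$, where $\mu_n$ is the uniform measure on $\{1,\dots,n\}$. Define $J:I^{\infty}\to\mathfrak{M}$ on the full-measure set of sequences with pairwise distinct coordinates by $J(\{x_n\})=\{t_n\}$, $t_n=\#\{i: 1\le i\le n,\ x_i\le x_n\}$. Then $J$ is a mod $0$ isomorphism of the measure spaces $(I^{\infty},m^{\infty})$ and $(\mathfrak{M},\mu)$ (it is defined almost everywhere, measure-preserving, and bijective mod $0$). Moreover, $J$ maps the sequence $\{\eta_n\}$ to the sequence $\{\tau_n\}$: the image of each element of $\eta_n$ is, mod $0$, an element of $\tau_n$.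
   Context: $\eta_n$ is the cylinder partition of $I^{\infty}$ whose base is the partition of $I^n$ (mod $0$) into open Weyl simplices: the sets of points of $(0,1)^n$ with pairwise distinct coordinates having a fixed collection of pairwise inequalities $x_i<x_j$ between their coordinates. $\tau_n$ is the partition of $\mathfrak{M}$ into classes of sequences whose first $n$ coordinates coincide. *)

(* Defs.v *)
From HB Require Import structures.
From mathcomp Require Import all_boot all_order all_algebra.
From mathcomp Require Import finmap.
From mathcomp Require Import all_classical all_reals all_analysis.

Set Implicit Arguments.
Unset Strict Implicit.
Unset Printing Implicit Defensive.
Import Order.TTheory GRing.Theory Num.Theory.
Import numFieldNormedType.Exports.

Local Open Scope classical_set_scope.
Local Open Scope ring_scope.

(* Sequences are indexed from 0: coordinate k below is the coordinate usually
   numbered k + 1. *)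

Section countable_product.
Context (d : measure_display) (T : nat -> measurableType d).

Definition seqprod : Type := forall n, T n.

HB.instance Definition _ := gen_eqMixin seqprod.
HB.instance Definition _ := gen_choiceMixin seqprod.
HB.instance Definition _ := isPointed.Build seqprod (fun=> point).

Definition seqprod_cylinders : set (set seqprod) :=
  \bigcup_n preimage_set_system setT (fun x : seqprod => x n) measurable.

HB.instance Definition _ :=
  Measurable.copy seqprod (g_sigma_algebraType seqprod_cylinders).

(* There is at most one such Q, since the boxes form a pi-system generating the
   sigma-algebra; its existence is Kolmogorov's theorem. *)
Definition is_product_measure (R : realType)
    (P : forall n, probability (T n) R) (Q : probability seqprod R) : Prop :=
  forall (n : nat) (A : forall i, set (T i)),
    (forall i, measurable (A i)) ->
    Q [set x : seqprod | forall i, (i < n)%N -> A i (x i)] =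
    (\prod_(i < n) P i (A i))%E.

End countable_product.

Section unit_interval.
Context (R : realType).

Definition I01 : Type := {x : R | 0 <= x <= 1}.

HB.instance Definition _ := Choice.on I01.
HB.instance Definition _ := isPointed.Build I01
  (exist _ 0 (introT andP (conj (lexx 0) ler01))).

Definition I01_val (x : I01) : R := sval x.

HB.instance Definition _ :=
  Measurable.copy I01 (g_sigma_algebra_preimageType I01_val).

Lemma I01_val_inj : injective I01_val.
Proof. exact: val_inj. Qed.

Lemma I01_image_preimage (B : set R) :
  I01_val @` (I01_val @^-1` B) = `[0, 1] `&` B.
Proof.
apply/seteqP; split => [_ [x Bx <-]|x [x01 Bx]].
  by split=> //=; rewrite in_itv/=; exact: (svalP x).
rewrite /= in_itv/= in x01.
by exists (exist _ x x01).
Qed.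

Lemma measurable_I01_image (A : set I01) :
  measurable A -> measurable (I01_val @` A).
Proof.
by case=> B mB <-; rewrite setTI I01_image_preimage; exact: measurableI.
Qed.

Definition lebesgue01 (A : set I01) : \bar R :=
  lebesgue_measure (I01_val @` A).

Let lebesgue01_0 : lebesgue01 set0 = 0%E.
Proof. by rewrite /lebesgue01 image_set0 measure0. Qed.

Let lebesgue01_ge0 A : (0 <= lebesgue01 A)%E.
Proof. exact: measure_ge0. Qed.

Let lebesgue01_sigma_additive : semi_sigma_additive lebesgue01.
Proof.
move=> F mF tF mUF; rewrite /lebesgue01 image_bigcup.
apply: measure_semi_sigma_additive.
- by move=> i; exact: measurable_I01_image.
- apply/trivIsetP => i j _ _ ij.
  apply/seteqP; split => // _ [[x Fx <-] [y Fy /I01_val_inj yx]].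
  have : (F i `&` F j) x by split; [exact: Fx|rewrite -yx].
  by move/trivIsetP : tF => ->.
- by apply: bigcup_measurable => i _; exact: measurable_I01_image.
Qed.

HB.instance Definition _ := isMeasure.Build _ _ _ lebesgue01
  lebesgue01_0 lebesgue01_ge0 lebesgue01_sigma_additive.

Let lebesgue01_setT : lebesgue01 setT = 1%E.
Proof.
rewrite /lebesgue01 -(preimage_setT I01_val) I01_image_preimage setIT.
by rewrite lebesgue_measure_itv/= lte_fin ltr01 oppr0 adde0.
Qed.

HB.instance Definition _ :=
  Measure_isProbability.Build _ _ _ lebesgue01 lebesgue01_setT.

End unit_interval.

Arguments lebesgue01 : clear implicits.

Section initial_segment.
Context (R : realType) (k : nat).

Definition seg : Type := {t : nat | (1 <= t <= k.+1)%N}.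

HB.instance Definition _ := Choice.on seg.
HB.instance Definition _ := isPointed.Build seg (exist _ 1%N isT).
HB.instance Definition _ := @isMeasurable.Build default_measure_display seg
  discrete_measurable discrete_measurable0
  discrete_measurableC discrete_measurableU.

Definition seg_uniform : set seg -> \bar R :=
  mscale (k.+1%:R^-1)%:nng counting.

HB.instance Definition _ := Measure.on seg_uniform.

Let seg_uniform_setT : seg_uniform setT = 1%E.
Proof.
pose f (t : seg) : nat := (sval t).-1.
have f_inj : injective f.
  move=> [[//|s] s1] [[//|t] t1]; rewrite /f/= => st.
  by apply: val_inj => /=; rewrite st.
have segT : ([set: seg] #= `I_k.+1)%card.
  have -> : `I_k.+1 = f @` setT.
    apply/seteqP; split => [t /= tk|_ [[[//|t] tk] _ <-]]; last exact: tk.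
    by exists (exist _ t.+1 tk).
  by rewrite card_eq_sym; apply: inj_card_eq => x y _ _; exact: f_inj.
rewrite /seg_uniform /mscale/= /counting asboolT; last by exists k.+1.
by rewrite (card_fset_set segT) -EFinM mulVf.
Qed.

HB.instance Definition _ :=
  Measure_isProbability.Build _ _ _ seg_uniform seg_uniform_setT.

End initial_segment.

Arguments seg_uniform : clear implicits.

Section mod0.
Context (R : realType) (d1 d2 : measure_display).
Context (T1 : measurableType d1) (T2 : measurableType d2).
Context (P : probability T1 R) (Q : probability T2 R).

(* f is only considered on D; its values outside D are irrelevant. *)
Record mod0_isomorphism (D : set T1) (f : T1 -> T2) : Prop := {
  mod0_measurable_domain : measurable D ;
  mod0_full_domain : P (~` D) = 0%E ;
  mod0_measurable : measurable_fun D f ;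
  mod0_measure_preserving :
    forall C, measurable C -> P (D `&` f @^-1` C) = Q C ;
  mod0_bijective : exists (A : set T1) (B : set T2),
    [/\ measurable A /\ P (~` A) = 0%E,
        measurable B /\ Q (~` B) = 0%E,
        A `<=` D,
        set_bij A B f &
        forall C, measurable C -> C `<=` A -> measurable (f @` C)] }.

Definition mod0_eq (A B : set T2) : Prop := Q.-negligible (A `+` B).

(* Partitions are given by their sets of elements; the image of E under the
   map f with domain D is f @` (E `&` D). *)
Definition maps_partition_mod0 (D : set T1) (f : T1 -> T2)
    (eta : set (set T1)) (tau : set (set T2)) : Prop :=
  (forall E, eta E -> exists2 F, tau F & mod0_eq (f @` (E `&` D)) F) /\
  (forall F, tau F -> exists2 E, eta E & mod0_eq (f @` (E `&` D)) F).

End mod0.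

Section rank_map.
Context (R : realType).

Definition Iinf : Type := seqprod (fun=> I01 R).
Definition frakM : Type := seqprod seg.

HB.instance Definition _ := Measurable.on Iinf.
HB.instance Definition _ := Measurable.on frakM.

Definition distinct_coordinates : set Iinf := [set x | injective x].

Definition rank (x : Iinf) (n : nat) : nat :=
  #|[pred i : 'I_n.+1 | I01_val (x i) <= I01_val (x n)]|.

Lemma rank_bounds (x : Iinf) (n : nat) : (1 <= rank x n <= n.+1)%N.
Proof.
apply/andP; split.
  by apply/card_gt0P; exists ord_max; rewrite inE /=.
by rewrite -[leqRHS]card_ord max_card.
Qed.

Definition J (x : Iinf) : frakM := fun n => exist _ (rank x n) (rank_bounds x n).

(* r i j records whether the inequality y_i < y_j holds; the simplex is empty
   unless r is a strict linear order. *)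
Definition weyl_simplex (n : nat) (r : rel 'I_n) : set ('I_n -> I01 R) :=
  [set y | [/\ forall i, 0 < I01_val (y i) < 1,
              injective y &
              forall i j, (I01_val (y i) < I01_val (y j)) = r i j]].

Definition eta (n : nat) : set (set Iinf) :=
  [set E | exists2 r : rel 'I_n, weyl_simplex r !=set0 &
     E = [set x : Iinf | weyl_simplex r (fun i => x i)]].

Definition tau (n : nat) : set (set frakM) :=
  [set F | exists s : frakM,
     F = [set t : frakM | forall i, (i < n)%N -> t i = s i]].

End rank_map.

Arguments distinct_coordinates : clear implicits.
Arguments J : clear implicits.
Arguments eta : clear implicits.

(* Main.v *)
(* The rank t_n says where x_n is inserted among x_1, ..., x_(n-1), so the first
   n ranks and the order of the first n coordinates determine each other.  The
   product measure is invariant under permutations of coordinates, hence each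
   order of the first n coordinates has probability at most 1 / n!, and so does
   each word of n ranks; since the n! words exhaust the space, each one has
   probability exactly 1 / n!, which is its mass under mu.  The sequence is
   recovered from its ranks because x_n is almost surely the limit of the
   frequency of {i <= N : x_i <= x_n}, an order-theoretic quantity: by a second
   moment bound this holds along N = 2 ^ j for rational thresholds, and then for
   x_n by monotonicity.  The resulting measurable left inverse of J makes images
   under J measurable. *)
From mathcomp Require Import all_boot all_order all_algebra.
From mathcomp Require Import perm finmap.
From mathcomp Require Import all_classical all_reals all_analysis.
From mathcomp Require Import measurable_realfun.
Require Import Defs.
Set Implicit Arguments.
Unset Strict Implicit.
Unset Printing Implicit Defensive.
Import Order.TTheory GRing.Theory Num.Theory.
Import numFieldNormedType.Exports.
Local Open Scope classical_set_scope.
Local Open Scope ring_scope.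

(** * Countable products *)

Section product_measurability.
Context (d : measure_display) (T : nat -> measurableType d).

Lemma measurable_coord n (A : set (T n)) : measurable A ->
  measurable [set x : seqprod T | A (x n)].
Proof.
move=> mA; apply: sub_sigma_algebra; exists n => //.
by exists A => //; rewrite setTI.
Qed.

Lemma measurable_fun_coord n :
  measurable_fun setT (fun x : seqprod T => x n).
Proof. by move=> _ A mA; rewrite setTI; exact: measurable_coord. Qed.

Lemma measurable_fun_seqprod d0 (T0 : measurableType d0)
    (f : T0 -> seqprod T) :
  (forall n, measurable_fun setT (fun x => f x n)) -> measurable_fun setT f.
Proof.
move=> mf.
apply: (@measurability _ _ _ (seqprod T) _ _ (@seqprod_cylinders d T)) => //.
by move=> _ [_ [n _ [A mA <-]] <-]; rewrite setTI; exact: mf.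
Qed.

Lemma measurable_box n (A : forall i, set (T i)) :
  (forall i, measurable (A i)) ->
  measurable [set x : seqprod T | forall i, (i < n)%N -> A i (x i)].
Proof.
move=> mA.
rewrite (_ : mkset _ = \bigcap_(i in `I_n) [set x | A i (x i)])//.
by apply: bigcap_measurableType => i _; exact: measurable_coord.
Qed.

Lemma product_measure_unique (R : realType)
    (P : forall n, probability (T n) R) (Q1 Q2 : probability (seqprod T) R) :
  is_product_measure P Q1 -> is_product_measure P Q2 ->
  forall E, measurable E -> Q1 E = Q2 E.
Proof.
move=> Q1P Q2P E mE.
pose G : set (set (seqprod T)) := [set B | exists n (A : forall i, set (T i)),
  (forall i, measurable (A i)) /\
  B = [set x : seqprod T | forall i, (i < n)%N -> A i (x i)]].
have GT : G setT.
  by exists 0%N, (fun=> setT); split => //; apply/seteqP; split.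
apply: (measure_unique G (fun=> setT)) => //.
- apply/seteqP; split.
    apply: smallest_sub; first exact: smallest_sigma_algebra.
    move=> _ [n _ [A mA <-]]; apply: sub_sigma_algebra; rewrite setTI.
    (* The preimage is a box of length n + 1 constrained only in place n; as the factor spaces
       depend on the index, [A] is transported along a proof of [i = n]. *)
    exists n.+1, (fun i => [set y | forall e : i = n, A (eq_rect i T y n e)]).
    split=> [i|]; last first.
      apply/seteqP; split => [x /= Ax i _ e|x /= /(_ n (ltnSn n) erefl)//].
      by subst n.
    have [e|ne] := pselect (i = n); last first.
      by rewrite (_ : mkset _ = setT)//; apply/seteqP; split => // y _ e.
    subst n; rewrite (_ : mkset _ = A)//; apply/seteqP; split => y /=.
      by move/(_ erefl).
    by move=> Ay e; rewrite (Prop_irrelevance e erefl).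
  apply: smallest_sub; first exact: sigma_algebra_measurable.
  by move=> _ [n [A [mA ->]]]; exact: measurable_box.
- move=> _ _ [m [A [mA ->]]] [n [B [mB ->]]].
  (* Both boxes are prolonged to the larger length by full factors. *)
  exists (maxn m n), (fun i => (if (i < m)%N then A i else setT) `&`
                               (if (i < n)%N then B i else setT)).
  split=> [i|]; first by apply: measurableI; case: ifP.
  apply/seteqP; split => x /=.
    by move=> [Ax Bx] i _; split; case: ifPn => // ?; [exact: Ax|exact: Bx].
  move=> ABx; split => i im.
    by have := ABx i; rewrite leq_max im => /(_ isT)[].
  by have := ABx i; rewrite leq_max im orbT => /(_ isT)[].
- by rewrite bigcup_const.
- by move=> _ [n [A [mA ->]]]; exact: etrans (Q1P n A mA) (esym (Q2P n A mA)).
- by move=> _; rewrite [X in (X < _)%E](probability_setT Q1) ltry.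
Qed.

End product_measurability.

(** * Injective reindexing of independent, identically distributed coordinates *)

Section iid.
Context (d : measure_display) (T : measurableType d) (R : realType).
Context (P : probability T R) (Q : probability (seqprod (fun=> T)) R).
Hypothesis QP : is_product_measure (fun=> P) Q.
Local Open Scope ereal_scope.

(** The constraints form an ordinary box: place [f i] carries [A i], and every other place below N
    carries the whole space, contributing a factor 1. *)
Lemma iid_box n (f : 'I_n -> nat) (A : 'I_n -> set T) : injective f ->
  (forall i, measurable (A i)) ->
  Q [set x | forall i, A i (x (f i))] = \prod_(i < n) P (A i).
Proof.
move=> f_inj mA.
pose N := (\max_(i < n) f i).+1.
have fN i : (f i < N)%N by rewrite ltnS; exact: leq_bigmax.
pose B j : set T := [set y | forall i, f i = j -> A i y].
have BfE i : B (f i) = A i.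
  by apply/seteqP; split=> [y /= /(_ i erefl)//|y Ay k /f_inj ->].
have BT j : (forall i, f i != j) -> B j = setT.
  by move=> fj; apply/seteqP; split => // y _ i /eqP; rewrite (negbTE (fj i)).
have mB j : measurable (B j).
  have [[i <-]|nj] := pselect (exists i, f i = j); first by rewrite BfE.
  by rewrite BT// => i; apply/eqP => ij; apply: nj; exists i.
rewrite (_ : mkset _ = [set x | forall j, (j < N)%N -> B j (x j)]); last first.
  apply/seteqP; split => x /=; first by move=> Ax j _ i <-.
  by move=> Bx i; rewrite -BfE; exact: Bx.
rewrite QP// (partition_big (fun i => Ordinal (fN i)) xpredT)//=.
apply: eq_bigr => j _.
have [[i ij]|nj] := pselect (exists i, f i = j); last first.
  rewrite big_pred0 => [|i]; last by apply/eqP => -[/(congr1 val)/= ij];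
    apply: nj; exists i.
  by rewrite BT ?probability_setT// => i; apply/eqP => ij; apply: nj; exists i.
rewrite (big_pred1 i); first by rewrite -ij BfE.
by move=> k; rewrite /= -val_eqE/= -ij (inj_eq f_inj).
Qed.

(** By [iid_box] the law of the reindexed sequence has the product values on boxes, so uniqueness
    identifies it with [Q]. *)
Lemma iid_preimage_comp (f : nat -> nat) (E : set (seqprod (fun=> T))) :
  injective f -> measurable E -> Q [set x | E (fun n => x (f n))] = Q E.
Proof.
move=> f_inj mE.
pose g (x : seqprod (fun=> T)) : seqprod (fun=> T) := fun n => x (f n).
have mg : measurable_fun setT g.
  by apply: measurable_fun_seqprod => n; exact: measurable_fun_coord.
pose Qg := distribution Q (mfun_Sub (mem_set mg)).
suff QgP : is_product_measure (fun=> P) Qg.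
  exact: (@product_measure_unique _ (fun=> T) _ (fun=> P) Qg Q).
move=> n A mA.
transitivity (Q [set x | forall i : 'I_n, A i (x (f i))]).
  congr (Q _); apply/seteqP; split => x /= Ax i; first exact: Ax.
  by move=> ni; exact: (Ax (Ordinal ni)).
apply: (@iid_box n (fun i => f i) (fun i => A i)) => // i j /f_inj/val_inj//.
Qed.

End iid.

(** * Ranks and order *)

Section rank_combinatorics.
Context (R : realType).
Implicit Types x y : Iinf R.

Definition count_le x N n : nat :=
  (\sum_(i < N.+1) (I01_val (x i) <= I01_val (x n))%R)%N.

Lemma rankE x n : rank x n = count_le x n n.
Proof. by rewrite /rank -sum1_card big_mkcond. Qed.

Lemma count_leS x N n : count_le x N.+1 n =
  (count_le x N n + (I01_val (x N.+1) <= I01_val (x n))%R)%N.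
Proof. by rewrite /count_le big_ord_recr. Qed.

Lemma rank_count_le x n : rank x n.+1 = (count_le x n n.+1).+1.
Proof. by rewrite rankE count_leS lexx addn1. Qed.

Lemma leq_count_le x N m n : I01_val (x m) <= I01_val (x n) ->
  (count_le x N m <= count_le x N n)%N.
Proof.
move=> mn; apply: leq_sum => i _.
by case: (leP (I01_val (x i)) (I01_val (x m))) => // /le_trans/(_ mn) ->.
Qed.

(** If coordinate m lies strictly below coordinate n, then coordinate n is counted on the right but
    not on the left; [n <= N] puts it among the counted ones. *)
Lemma ltn_count_le x N m n : (n <= N)%N ->
  (count_le x N m < count_le x N n)%N = (I01_val (x m) < I01_val (x n)).
Proof.
move=> nN; case: ltP => [mn|/(leq_count_le N)]; last first.
  by rewrite leqNgt => /negbTE.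
pose i0 : 'I_N.+1 := Ordinal (nN : (n < N.+1)%N).
rewrite /count_le (bigD1 i0)//= (bigD1 i0 (P := xpredT))//= lexx leNgt mn/=.
rewrite add0n add1n ltnS; apply: leq_sum => i _.
by case: (leP (I01_val (x i)) (I01_val (x m))) => // /le_trans/(_ (ltW mn)) ->.
Qed.

(* Inserting a coordinate of rank r shifts exactly the ranks that are at least
   r, so this is the rank of coordinate n among the first n + k + 1 ones. *)
Fixpoint relative_rank (t : frakM) n k : nat :=
  if k is k'.+1 then
    let p := relative_rank t n k' in (p + (sval (t (n + k)%N) <= p)%N)%N
  else sval (t n).

Lemma eq_relative_rank (s t : frakM) n k :
  (forall i, (i <= n + k)%N -> s i = t i) ->
  relative_rank s n k = relative_rank t n k.
Proof.
elim: k => [|k IH] st /=; first by rewrite st ?addn0.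
by rewrite IH ?st// => i ik; apply: st; rewrite addnS (leq_trans ik).
Qed.

(** Each new coordinate lies below coordinate n exactly when its own rank is at most the current
    count p; injectivity makes weak and strict comparison agree. *)
Lemma count_le_relative_rank x n k :
  {in [pred i | i <= n + k]%N &, injective x} ->
  count_le x (n + k) n = relative_rank (J R x) n k.
Proof.
elim: k => [|k IH] x_inj; first by rewrite addn0 /= rankE.
rewrite addnS count_leS [RHS]/= -IH => [|i j]; last first.
  rewrite !inE => ik jk.
  by apply: x_inj; rewrite inE addnS (leq_trans ik, leq_trans jk).
congr (_ + nat_of_bool _)%N.
rewrite addnS /= rank_count_le ltn_count_le ?leq_addr// lt_neqAle.
rewrite (_ : _ != _)//; apply/eqP => /I01_val_inj/x_inj.
by rewrite !inE addnS leqnn ltnW ?ltnS ?leq_addr// => /(_ isT isT)/eqP;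
  rewrite gtn_eqF// ltnS leq_addr.
Qed.

(** Comparing coordinates amounts to comparing their counts among the first n, and [relative_rank]
    computes these counts from the ranks alone. *)
Lemma eq_rank_order x y n :
  {in [pred i | i < n]%N &, injective x} ->
  {in [pred i | i < n]%N &, injective y} ->
  (forall i, (i < n)%N -> J R x i = J R y i) ->
  forall i j, (i < n)%N -> (j < n)%N ->
  (I01_val (x i) < I01_val (x j)) = (I01_val (y i) < I01_val (y j)).
Proof.
case: n => // N x_inj y_inj xy i j iN jN.
rewrite -!(@ltn_count_le _ N)//.
suff E k : (k < N.+1)%N -> count_le x N k = count_le y N k by rewrite !E.
rewrite ltnS => kN; rewrite -(subnKC kN).
rewrite !count_le_relative_rank; last 2 first.
  by move=> ? ?; rewrite !inE subnKC//; exact: y_inj.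
  by move=> ? ?; rewrite !inE subnKC//; exact: x_inj.
by apply: eq_relative_rank => l; rewrite subnKC//; exact: xy.
Qed.

Lemma eq_order_rank x y n :
  (forall i j, (i < n)%N -> (j < n)%N ->
    (I01_val (x i) < I01_val (x j)) = (I01_val (y i) < I01_val (y j))) ->
  forall i, (i < n)%N -> J R x i = J R y i.
Proof.
move=> xy i ni; apply: val_inj => /=; rewrite !rankE.
apply: eq_bigr => j _; rewrite !leNgt xy//.
by rewrite (leq_ltn_trans _ ni)// -ltnS.
Qed.

End rank_combinatorics.

(** * Measurability *)

Section measurability.
Context (d : measure_display) (T : measurableType d).

Lemma measurable_I01_val (R : realType) : measurable_fun setT (@I01_val R).
Proof. by move=> _ B mB; rewrite setTI; exists B => //; rewrite setTI. Qed.

Lemma measurable_fun_I01 (R : realType) (f : T -> I01 R) :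
  measurable_fun setT (fun x => I01_val (f x)) -> measurable_fun setT f.
Proof. by move=> mf _ _ [B mB <-]; rewrite setTI; exact: mf. Qed.

(** Only countably many pairs of values occur, so every preimage is a countable union of
    intersections of level sets. *)
Lemma measurable_fun_nat_op (f g : T -> nat) (h : nat -> nat -> nat) :
  measurable_fun setT f -> measurable_fun setT g ->
  measurable_fun setT (fun x => h (f x) (g x)).
Proof.
move=> mf mg _ Y _; rewrite setTI.
rewrite (_ : _ @^-1` Y = \bigcup_a \bigcup_(b in [set b | Y (h a b)])
    (f @^-1` [set a] `&` g @^-1` [set b])).
  apply: bigcup_measurable => a _; apply: bigcup_measurable => b _.
  by apply: measurableI; rewrite -[X in measurable X]setTI;
    [exact: mf|exact: mg].
apply/seteqP; split => [x Yx|x [a _ [b Yab [/= fa gb]]]].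
  by exists (f x) => //; exists (g x).
by rewrite /preimage/= fa gb.
Qed.

Lemma measurable_fun_seg k (f : T -> seg k) :
  measurable_fun setT (fun x => sval (f x)) -> measurable_fun setT f.
Proof.
move=> mf _ Y _; rewrite setTI.
rewrite (_ : _ @^-1` Y = [set: T] `&` (fun x => sval (f x)) @^-1` (sval @` Y)).
  exact: mf.
rewrite setTI; apply/seteqP; split => [x Yx|x [y Yy /val_inj yx]].
  by exists (f x).
by rewrite /preimage/= -yx.
Qed.

End measurability.

Section rank_measurability.
Context (R : realType).

Lemma measurable_coord_val n :
  measurable_fun setT (fun x : Iinf R => I01_val (x n)).
Proof.
apply: (measurableT_comp (@measurable_I01_val R)).
exact: (@measurable_fun_coord _ (fun=> I01 R)).
Qed.

Lemma measurable_sval_coord n :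
  measurable_fun setT (fun t : frakM => sval (t n)).
Proof.
apply: (@measurableT_comp _ _ _ _ _ _ (fun s : seg n => sval s)).
  by move=> _ Y _; exact: I.
exact: (@measurable_fun_coord _ seg).
Qed.

Lemma measurable_rank n : measurable_fun setT (fun x : Iinf R => rank x n).
Proof.
(* The number m of summands is separated from the index n of the threshold, so that the induction
   runs on m alone. *)
suff mS m : measurable_fun setT (fun x : Iinf R =>
    (\sum_(i < m) (I01_val (x i) <= I01_val (x n))%R)%N).
  rewrite (_ : (fun x : Iinf R => rank x n) = (fun x => count_le x n n)).
    exact: mS.
  by apply/funext => x; exact: rankE.
elim: m => [|m IH].
  rewrite (_ : (fun x : Iinf R => _) = cst 0%N)//.
  by apply/funext => x; rewrite big_ord0.
rewrite (_ : (fun x : Iinf R => _) = (fun x : Iinf R =>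
    (\sum_(i < m) (I01_val (x i) <= I01_val (x n))%R +
     (I01_val (x m) <= I01_val (x n))%R)%N)); last first.
  by apply/funext => x; rewrite big_ord_recr.
apply: (@measurable_fun_nat_op _ _ _ _ addn) => //.
apply: (@measurableT_comp _ _ _ _ _ _ nat_of_bool) => //.
by apply: measurable_fun_ler; exact: measurable_coord_val.
Qed.

Lemma measurable_J : measurable_fun setT (J R).
Proof.
apply: measurable_fun_seqprod => n; apply: measurable_fun_seg.
exact: measurable_rank.
Qed.

Lemma measurable_relative_rank n k :
  measurable_fun setT (fun t => relative_rank t n k).
Proof.
elim: k => [|k IH]; first exact: measurable_sval_coord.
exact: (@measurable_fun_nat_op _ _ _ _ (fun p s => (p + (s <= p)%N)%N) IH
  (measurable_sval_coord _)).
Qed.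

Lemma measurable_distinct_coordinates : measurable (distinct_coordinates R).
Proof.
rewrite (_ : distinct_coordinates R =
  \bigcap_i \bigcap_(j in [set j | j != i])
    [set x | I01_val (x i) != I01_val (x j)]).
  apply: bigcap_measurableType => i _; apply: bigcap_measurableType => j _.
  rewrite -[X in measurable X]setTI.
  exact: (measurable_neg (measurable_fun_eqr (measurable_coord_val i)
    (measurable_coord_val j)) measurableT (Y := [set true])).
apply/seteqP; split => [x x_inj i _ j /= ji|x /= xij i j xji].
  by apply: contra ji => /eqP/I01_val_inj/x_inj ->.
by apply/eqP; apply/negPn/negP => /(xij j I i)/=; rewrite xji eqxx.
Qed.

(** Weyl simplices lie in the open cube, and an interior value has rationals of [[0, 1]] on both
    sides. *)
Definition interior_coordinates : set (Iinf R) :=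
  [set x | forall n, 0 < I01_val (x n) < 1].

Lemma measurable_interior_coordinates : measurable interior_coordinates.
Proof.
rewrite (_ : interior_coordinates = \bigcap_n [set x | 0 < I01_val (x n) < 1]).
  apply: bigcap_measurableType => n _; rewrite -[X in measurable X]setTI.
  apply: (measurable_and (measurable_fun_ltr _ _) (measurable_fun_ltr _ _)
    measurableT (Y := [set true])) => //;
  exact: measurable_coord_val.
by apply/seteqP; split => [x xn n _|x xn n]; exact: xn.
Qed.

End rank_measurability.

(** * A law of large numbers along powers of two *)

Section law_of_large_numbers.
Context (d : measure_display) (T : measurableType d) (R : realType).
Context (P : probability T R) (B : nat -> set T) (q : R).
Hypothesis q01 : 0 <= q <= 1.
Hypothesis mB : forall i, measurable (B i).
Hypothesis PB : forall i, P (B i) = q%:E.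
Hypothesis PBB : forall i j, i != j -> P (B i `&` B j) = (q * q)%:E.

Let Y i (x : T) : R := \1_(B i) x - q.

Let iB A : measurable A -> P.-integrable setT (EFin \o \1_A).
Proof. exact: integrable_indic. Qed.

Let ic c : P.-integrable setT (EFin \o cst c).
Proof. exact: finite_measure_integrable_cst. Qed.

(** Expansion into indicators, whose integrals are the probabilities given by [PB] and [PBB]. *)
Let YYE i j x : Y i x * Y j x =
  \1_(B i `&` B j) x + (- q * \1_(B i) x + (- q * \1_(B j) x + q ^+ 2)).
Proof.
rewrite indicI /Y/= mulrBl !mulrBr opprB !mulNr expr2 (mulrC _ q) -!addrA.
by rewrite [q * q - _]addrC.
Qed.

Let iZ c (A : set T) : measurable A ->
  P.-integrable setT (EFin \o (fun x => c * \1_A x)).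
Proof. by move=> mA; exact: (integrableZl measurableT c (iB mA)). Qed.

Let iYY i j : P.-integrable setT (fun x => (Y i x * Y j x)%:E).
Proof.
under eq_fun do rewrite YYE.
apply: (integrableD measurableT (f := EFin \o _) (g := EFin \o _)).
  exact/iB/measurableI.
apply: (integrableD measurableT (f := EFin \o _) (g := EFin \o _)).
  exact: iZ.
apply: (integrableD measurableT (f := EFin \o _) (g := EFin \o _)).
  exact: iZ.
exact: ic.
Qed.

(** The centered indicators are pairwise orthogonal; the diagonal value is the Bernoulli
    variance. *)
Let integral_YY i j :
  (\int[P]_x (Y i x * Y j x)%:E = (if i == j then q * (1 - q) else 0)%:E)%E.
Proof.
under eq_integral do rewrite YYE 3!EFinD 2!(EFinM (- q)).
rewrite integralD//=; last 2 first.
- exact/iB/measurableI.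
- apply: (integrableD measurableT (f := EFin \o _) (g := EFin \o _)).
    exact: iZ.
  apply: (integrableD measurableT (f := EFin \o _) (g := EFin \o _)).
    exact: iZ.
  exact: ic.
rewrite integralD//=; last 2 first.
- exact: iZ.
- apply: (integrableD measurableT (f := EFin \o _) (g := EFin \o _)).
    exact: iZ.
  exact: ic.
rewrite integralD//=; last 2 first.
- exact: iZ.
- exact: ic.
rewrite !integralZl//; last 2 first.
- exact: iB.
- exact: iB.
rewrite integral_cst// !integral_indic//; last exact: measurableI.
rewrite !setIT.
change (P (B i `&` B j) + ((- q)%:E * P (B i) +
  ((- q)%:E * P (B j) + (q ^+ 2)%:E * P setT)) =
  (if i == j then q * (1 - q) else 0)%:E)%E.
rewrite !PB probability_setT mule1 -!EFinM.
have [->|ij] := eqVneq i j.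
  by rewrite setIid PB -!EFinD expr2 mulNr addNr addr0 mulrBr mulr1.
by rewrite PBB// -!EFinD expr2 mulNr addNr addr0 subrr.
Qed.

Let S N x : R := \sum_(i < N) Y i x.

(** By orthogonality only the N diagonal terms survive, each at most 1. *)
Let integral_S2 N : (\int[P]_x ((S N x) ^+ 2)%:E <= N%:R%:E)%E.
Proof.
under eq_integral do rewrite expr2 mulr_suml -sumEFin.
rewrite integral_sum//; last first.
  move=> i; under eq_fun do rewrite mulr_sumr -sumEFin.
  by apply: integrable_sum => // j _; exact: iYY.
rewrite (eq_bigr (fun=> (q * (1 - q))%:E)) => [|i _]; last first.
  under eq_integral do rewrite mulr_sumr -sumEFin.
  rewrite integral_sum//.
  under eq_bigr do rewrite integral_YY.
  rewrite sumEFin; congr EFin.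
  by rewrite -big_mkcond/= (big_pred1 i).
rewrite sumEFin lee_fin -[leRHS]mulr_natr mul1r.
rewrite -[N in leRHS]card_ord -sumr_const.
apply: ler_sum => i _.
by move/andP: q01 => [q0 q1]; rewrite mulr_ile1 ?subr_ge0// gerBl.
Qed.

(** The mean of N centered terms has second moment at most 1 / N, which is summable along N = 2 ^ j.
    So the squared deviations have an almost everywhere finite sum and tend to 0. *)
Lemma law_of_large_numbers_pow2 : {ae P, forall x,
  (\sum_(i < 2 ^ j) \1_(B i) x) / (2 ^ j)%:R @[j --> \oo] --> q}.
Proof.
pose g j x : R := S (2 ^ j) x / (2 ^ j)%:R.
pose f j x : \bar R := ((g j x) ^+ 2)%:E.
have p2 j : 0 < ((2 ^ j)%:R : R) by rewrite ltr0n expn_gt0.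
have mS N : measurable_fun setT (S N).
  by apply: measurable_sum => i; exact: measurable_funB.
have mf j : measurable_fun setT (f j).
  apply/measurable_EFinP/measurable_funX; apply: measurable_funM => //.
have f0 j x : (0 <= f j x)%E by rewrite lee_fin sqr_ge0.
(* The bound 1 / 2 ^ j is written in the shape of the geometric series summed below. *)
have If j : (\int[P]_x f j x <= (2 / (2 ^ (j + 1))%:R)%:E)%E.
  rewrite /f /g; under eq_integral do rewrite exprMn mulrC EFinM.
  rewrite ge0_integralZl_EFin ?sqr_ge0//;
    [|by move=> x _; rewrite lee_fin sqr_ge0
     |exact/measurable_EFinP/measurable_funX].
  apply: (@le_trans _ _ (((2 ^ j)%:R^-1 ^+ 2)%:E * ((2 ^ j)%:R)%:E)%E).
    by rewrite lee_pmul2l// ?lte_fin ?exprn_gt0// invr_gt0.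
  rewrite -EFinM lee_fin addn1 expnS natrM.
  by rewrite invfM mulrA divff// mul1r expr2 -mulrA mulVf ?mulr1// gt_eqF.
have If_fin : (\int[P]_x (\sum_(j <oo) f j x) < +oo)%E.
  rewrite integral_nneseries//.
  apply: (@le_lt_trans _ _ (\sum_(j <oo) (2 / (2 ^ (j + 1))%:R)%:E)%E).
    by apply: lee_nneseries => // j _ _; exact: integral_ge0.
  have /cvg_lim := @cvg_geometric_eseries_half R 2 0.
  by move=> ->//; rewrite ltry.
have : {ae P, forall x, setT x -> (\sum_(j <oo) f j x)%E \is a fin_num}.
  apply: integrable_ae => //; apply/integrableP; split.
    exact: ge0_emeasurable_sum.
  under eq_integral do rewrite gee0_abs ?nneseries_ge0//.
  exact: If_fin.
apply: filterS => x /(_ I) fx.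
have /cvg_series_cvg_0 g2 : cvgn (series (fun j => (g j x) ^+ 2)).
  apply: nnseries_is_cvg => [j|]; first exact: sqr_ge0.
  rewrite -ge0_fin_numE; first exact: fx.
  by apply: nneseries_ge0 => j _ _; exact: f0.
apply/cvgrPdist_lt => e e0.
have e20 : 0 < e ^+ 2 by rewrite exprn_gt0.
have /cvgrPdist_lt/(_ _ e20) := g2.
apply: filterS => j; rewrite sub0r normrN ger0_norm ?sqr_ge0// => gje.
rewrite distrC (_ : _ - q = g j x).
  by rewrite -(@ltr_pXn2r _ 2)// ?nnegrE ?ltW// real_normK ?num_real.
rewrite /g /S /Y sumrB sumr_const card_ord mulrBl; congr (_ - _).
by rewrite -[q *+ _]mulr_natr mulfK// gt_eqF.
Qed.

End law_of_large_numbers.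

(** * Uniform sequences *)

Section uniform_sequence.
Context (R : realType) (m : probability (Iinf R) R).
Hypothesis Hm : is_product_measure (fun=> lebesgue01 R) m.

Lemma measurable_I01_le (q : R) : measurable [set y : I01 R | I01_val y <= q].
Proof.
exists `]-oo, q]%classic; first exact: measurable_itv.
by rewrite setTI; apply/seteqP; split => y /=; rewrite in_itv.
Qed.

Lemma lebesgue01_le (q : R) : 0 <= q <= 1 ->
  lebesgue01 R [set y | I01_val y <= q] = q%:E.
Proof.
move=> /andP[q0 q1].
rewrite /lebesgue01.
rewrite (_ : mkset _ = I01_val (R := R) @^-1` `]-oo, q]%classic); last first.
  by apply/seteqP; split => y /=; rewrite in_itv.
rewrite I01_image_preimage (_ : _ `&` _ = `[0, q]%classic); last first.
  apply/seteqP; split => y /=; rewrite !in_itv/=.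
    by move=> [/andP[-> _] ->].
  by move=> /andP[-> yq]; rewrite (le_trans yq).
by rewrite lebesgue_measure_itv/= lte_fin; case: ltP => [_|q0'];
  [rewrite oppr0 adde0|congr EFin; apply/le_anti; rewrite q0 q0'].
Qed.

(** Only a bound, since the interval may stick out of [[0, 1]], as the last cell in [null_diagonal]
    does. *)
Lemma lebesgue01_itvco_le (a b : R) : a <= b ->
  measurable [set y : I01 R | a <= I01_val y < b] /\
  (lebesgue01 R [set y | (a <= I01_val y < b)%R] <= (b - a)%:E)%E.
Proof.
move=> ab.
have E : [set y : I01 R | a <= I01_val y < b] =
    I01_val (R := R) @^-1` `[a, b[%classic.
  by apply/seteqP; split => y /=; rewrite in_itv.
rewrite E; split; first by exists `[a, b[%classic; rewrite ?setTI.
rewrite /lebesgue01 I01_image_preimage.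
apply: (@le_trans _ _ (lebesgue_measure (`[a, b[%classic : set R))).
  by rewrite le_measure ?inE//; exact: measurableI.
rewrite lebesgue_measure_itv/= lte_fin; case: ifP => _; first by rewrite EFinB.
by rewrite lee_fin subr_ge0.
Qed.

Lemma uniform_coord i (A : set (I01 R)) : measurable A ->
  m [set x : Iinf R | A (x i)] = lebesgue01 R A.
Proof.
move=> mA.
have := @iid_box _ _ _ _ _ Hm 1 (fun=> i) (fun=> A).
rewrite big_ord1 => <- //; last by move=> a b _; rewrite !ord1.
by congr (m _); apply/seteqP; split => x /=; [|apply; exact: ord0].
Qed.

Lemma uniform_coord2 (i j : nat) (A B : set (I01 R)) : i != j ->
  measurable A -> measurable B ->
  m [set x : Iinf R | A (x i) /\ B (x j)] = (lebesgue01 R A * lebesgue01 R B)%E.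
Proof.
move=> ij mA mB.
have := @iid_box _ _ _ _ _ Hm 2 (fun k => if k == ord0 then i else j)
  (fun k => if k == ord0 then A else B).
rewrite big_ord_recl big_ord1/= => <-.
- congr (m _); apply/seteqP; split => x /=.
    by move=> [Ax Bx] k; case: ifP.
  by move=> ABx; split; [exact: (ABx ord0)|exact: (ABx (lift ord0 ord0))].
- move=> a b; case: ifPn => a0; case: ifPn => b0.
  + by rewrite (eqP a0) (eqP b0).
  + by move=> ij'; rewrite ij' eqxx in ij.
  + by move=> ij'; rewrite ij' eqxx in ij.
  + move=> _; apply: val_inj; move: a b a0 b0.
    by move=> [[|[|//]]] ? [[|[|//]]].
- by move=> k; case: ifP.
Qed.

Lemma null_coord i c : m.-negligible [set x : Iinf R | I01_val (x i) = c].
Proof.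
have mc : measurable [set y : I01 R | I01_val y = c].
  exists [set c] => //; rewrite setTI//.
have -> : [set x : Iinf R | I01_val (x i) = c] =
    [set x : Iinf R | [set y : I01 R | I01_val y = c] (x i)] by [].
apply/negligibleP; first exact: (@measurable_coord _ (fun=> I01 R)).
apply: etrans (uniform_coord i mc) _; apply/eqP; rewrite -measure_le0.
change (lebesgue_measure (@I01_val R @` (@I01_val R @^-1` [set c])) <= 0)%E.
rewrite I01_image_preimage -(lebesgue_measure_set1 c).
by rewrite le_measure ?inE//; exact: measurableI.
Qed.

(** By independence the covering squares have total mass at most (N + 1) / N ^ 2 <= 2 / N. *)
Lemma null_diagonal (i j : nat) : i != j ->
  m.-negligible [set x : Iinf R | I01_val (x i) = I01_val (x j)].
Proof.
move=> ij; set E := mkset _.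
have mE : measurable E.
  rewrite -[X in measurable X]setTI.
  rewrite (_ : E = [set x : Iinf R | I01_val (x i) == I01_val (x j)]).
    exact: (measurable_fun_eqr (measurable_coord_val i)
      (measurable_coord_val j) measurableT (Y := [set true])).
  by apply/seteqP; split => x /= /eqP.
apply/negligibleP => //; apply/eqP; rewrite -measure_le0.
apply/lee_addgt0Pr => e e0.
rewrite add0e.
(* Chosen so that 2 / N < e. *)
pose N := (Num.truncn (2 / e)).+1.
have N0 : 0 < (N%:R : R) by [].
(* The diagonal is covered by N + 1 squares of side 1 / N. *)
pose B k : set (I01 R) := [set y | k%:R / N%:R <= I01_val y < k.+1%:R / N%:R].
pose BB k := [set x : Iinf R | B k (x i) /\ B k (x j)].
have BN k : measurable (B k) /\ (lebesgue01 R (B k) <= (N%:R^-1)%:E)%E.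
  have -> : N%:R^-1 = k.+1%:R / N%:R - k%:R / N%:R :> R.
    by rewrite -mulrBl -natrB// subSnn mul1r.
  by apply: lebesgue01_itvco_le; rewrite ler_pM2r ?invr_gt0// ler_nat.
apply: (@le_trans _ _ (\sum_(k < N.+1) m (BB k))%E).
  apply: (@content_subadditive _ _ _ m E BB) => //.
    move=> k _; apply: measurableI; apply: (@measurable_coord _ (fun=> I01 R));
    exact: (BN k).1.
  rewrite -(bigcup_mkord _ BB) => x Ex.
  have /andP[x0 x1] : 0 <= I01_val (x i) <= 1 := svalP (x i).
  have xN : 0 <= I01_val (x i) * N%:R by rewrite mulr_ge0.
  (* The cells are half-open, so the value 1 falls into cell N; hence N + 1 cells. *)
  exists (Num.truncn (I01_val (x i) * N%:R)).
    rewrite /= ltnS -(ler_nat R).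
    rewrite (@le_trans _ _ (I01_val (x i) * N%:R)) ?truncn_le//.
    by rewrite ler_piMl.
  rewrite /BB/B/= -Ex; suff : B (Num.truncn (I01_val (x i) * N%:R)) (x i) by [].
  by rewrite /B/= ler_pdivrMr// ltr_pdivlMr// truncn_itv.
apply: (@le_trans _ _ (\sum_(k < N.+1) (N%:R^-1 * N%:R^-1)%:E)%E).
  apply: lee_sum => k _; rewrite uniform_coord2 ?EFinM//; try exact: (BN k).1.
  by apply: lee_pmul => //; exact: (BN k).2.
rewrite sumEFin lee_fin sumr_const card_ord -[leLHS]mulr_natr.
rewrite -mulrA (@le_trans _ _ (N%:R^-1 * 2))//.
  rewrite ler_pM2l ?invr_gt0// ler_pdivrMl// mulr_natr -mulrnA ler_nat.
  by rewrite muln2 -addnn -addn1 leq_add2l.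
by rewrite ler_pdivrMl// -ler_pdivrMr// ltW// /N truncnS_gt.
Qed.

End uniform_sequence.

(** * Recovering a sequence from its ranks *)

Section reconstruction.
Context (R : realType) (m : probability (Iinf R) R).
Hypothesis Hm : is_product_measure (fun=> lebesgue01 R) m.

Let ae_filter := ae_filter_ringOfSetsType m.

Lemma ae_distinct : {ae m, forall x, distinct_coordinates R x}.
Proof.
have : {ae m, forall x, forall i j : nat,
    I01_val (x i) = I01_val (x j) -> i = j}.
  apply: ae_foralln => i; apply: ae_foralln => j.
  have [->|ij] := eqVneq i j; first exact: aeW.
  apply: negligibleS (null_diagonal Hm ij) => x /= xij.
  by apply: contrapT => xij'; apply: xij.
by apply: (@filterS _ _ ae_filter) => x x_inj i j xij; apply: x_inj;
  rewrite xij.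
Qed.

Lemma ae_interior : {ae m, forall x, interior_coordinates x}.
Proof.
apply: ae_foralln => n.
have := negligibleU (null_coord Hm n 0) (null_coord Hm n 1).
apply: negligibleS => x /= xn.
have /andP[x0 x1] : 0 <= I01_val (x n) <= 1 := svalP (x n).
have [->|n0] := eqVneq (I01_val (x n)) 0; first by left.
have [->|n1] := eqVneq (I01_val (x n)) 1; first by right.
by exfalso; apply: xn; rewrite !lt_neqAle eq_sym n0 x0 n1 x1.
Qed.

Definition empirical (x : Iinf R) (q : R) j : R :=
  (\sum_(i < 2 ^ j) (I01_val (x i) <= q)%R)%N%:R / (2 ^ j)%:R.

Lemma ae_empirical_cst (q : R) : 0 <= q <= 1 ->
  {ae m, forall x, empirical x q j @[j --> \oo] --> q}.
Proof.
move=> q01; pose B i := [set x : Iinf R | I01_val (x i) <= q].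
have mB i : measurable (B i).
  exact: (@measurable_coord _ (fun=> I01 R) i _ (measurable_I01_le q)).
have := @law_of_large_numbers_pow2 _ _ _ m B q q01 mB.
have PB i : m (B i) = q%:E.
  exact: etrans (uniform_coord Hm i (measurable_I01_le q)) (lebesgue01_le q01).
have PBB (i j : nat) : i != j -> m (B i `&` B j) = (q * q)%:E.
  move=> ij.
  have mq := measurable_I01_le q.
  apply: etrans (uniform_coord2 Hm ij mq mq) _.
  by rewrite lebesgue01_le.
move=> /(_ PB PBB); apply: (@filterS _ _ ae_filter) => x; rewrite /empirical.
have -> // : (fun j => (\sum_(i < 2 ^ j) \1_(B i) x) / (2 ^ j)%:R) =
  (fun j => (\sum_(i < 2 ^ j) (I01_val (x i) <= q)%R)%N%:R / (2 ^ j)%:R)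
  :> (nat -> R).
apply/funext => j; congr (_ / _); rewrite natr_sum; apply: eq_bigr => i _.
by rewrite indicE; congr (nat_of_bool _)%:R; apply/idP/idP; rewrite inE.
Qed.

(** The threshold [x n] varies with the sequence, so the law is first taken at all rational
    thresholds at once; monotonicity in the threshold then squeezes the frequency at [x n]. *)
Lemma ae_empirical :
  {ae m, forall x n,
    empirical x (I01_val (x n)) j @[j --> \oo] --> I01_val (x n)}.
Proof.
(* Rationals are enumerated by their codes, so that [ae_foralln] applies; a number coding no
   rational imposes nothing. *)
pose cvg_at k (x : Iinf R) := if choice.unpickle k is Some r then
  0 <= (ratr (r : rat) : R) <= 1 ->
  empirical x (ratr r) j @[j --> \oo] --> (ratr r : R) else True.
have : {ae m, forall x, forall k, cvg_at k x}.
  apply: ae_foralln => k; rewrite /cvg_at.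
  case: (choice.unpickle k) => [r|]; last exact: aeW.
  have [r01|r01] := boolP (0 <= (ratr r : R) <= 1); last by apply: aeW => x.
  by apply: (@filterS _ _ ae_filter) (ae_empirical_cst r01).
apply: (@filterS2 _ _ ae_filter _ _ _ _ ae_interior) => x x01 xr n.
have {}xr (r : rat) : 0 <= (ratr r : R) <= 1 ->
    empirical x (ratr r) j @[j --> \oo] --> (ratr r : R).
  by have := xr (choice.pickle r); rewrite /cvg_at choice.pickleK.
have le_empirical p q j : p <= q -> empirical x p j <= empirical x q j.
  move=> pq; rewrite ler_pM2r ?invr_gt0 ?ltr0n ?expn_gt0// ler_nat.
  by apply: leq_sum => i _; case: (leP _ p) => // /le_trans/(_ pq) ->.
have /andP[x0 x1] := x01 n.
apply/cvgrPdist_lt => e e0.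
(* The bounds 0 here and 1 for q keep both rationals in [[0, 1]]. *)
have [p /[!in_itv]/= /andP[xp px]] :
    exists p, ratr p \in `](Num.max 0 (I01_val (x n) - e)), (I01_val (x n))[.
  by apply: rat_in_itvoo; rewrite gt_max x0 gtrBl.
have [q /[!in_itv]/= /andP[xq qx]] :
    exists q, ratr q \in `](I01_val (x n)), (Num.min 1 (I01_val (x n) + e))[.
  by apply: rat_in_itvoo; rewrite lt_min x1 ltrDl.
move: xp qx; rewrite gt_max lt_min => /andP[p0 xp] /andP[q1 qx].
have p01 : 0 <= (ratr p : R) <= 1 by rewrite (ltW p0) (ltW (lt_trans px x1)).
have q01 : 0 <= (ratr q : R) <= 1 by rewrite (ltW q1) (ltW (lt_trans x0 xq)).
near=> j; rewrite distrC ltr_distl; apply/andP; split.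
  apply: lt_le_trans (le_empirical _ _ _ (ltW px)).
  by near: j; exact: cvgr_gt (xr p p01) _ xp.
apply: le_lt_trans (le_empirical _ _ _ (ltW xq)) _.
by near: j; exact: cvgr_lt (xr q q01) _ qx.
Unshelve. all: by end_near. Qed.

(* The position of coordinate n among the first 2 ^ j ones, divided by 2 ^ j;
   meaningful once n < 2 ^ j. *)
Definition relative_frequency (t : frakM) n j : R :=
  (relative_rank t n (2 ^ j - n.+1))%:R / (2 ^ j)%:R.

(** Truncation supplies the membership proof required by [rebuild] and fixes the values already in
    [[0, 1]]. *)
Definition clip (r : R) : R := Num.max 0 (Num.min 1 r).

Lemma clip_itv r : 0 <= clip r <= 1.
Proof. by rewrite /clip le_max lexx/= ge_max ler01 ge_min lexx. Qed.

(** The upper limit exists for every rank sequence and is measurable in it, which makes [rebuild] a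
    total measurable map. *)
Definition rebuild (t : frakM) : Iinf R := fun n =>
  exist _ (clip (fine (limn_esup (fun j => (relative_frequency t n j)%:E))))
    (clip_itv _).

Lemma measurable_rebuild : measurable_fun setT rebuild.
Proof.
apply: (@measurable_fun_seqprod _ (fun=> I01 R)) => n.
apply: measurable_fun_I01.
apply: measurable_maxr; first exact: measurable_cst.
apply: measurable_minr; first exact: measurable_cst.
apply: (@measurableT_comp _ _ _ _ _ _ (@fine R)) => //.
apply: measurable_fun_limn_esup => j; apply/measurable_EFinP.
apply: measurable_funM; last exact: measurable_cst.
apply: (@measurableT_comp _ _ _ _ _ _ (fun k : nat => k%:R : R)) => //.
exact: measurable_relative_rank.
Qed.

(** Once n < 2 ^ j, the frequency read from the ranks is the empirical frequency at threshold [x n],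
    so the upper limit is a genuine limit. *)
Lemma rebuild_J (x : Iinf R) : distinct_coordinates R x ->
  (forall n, empirical x (I01_val (x n)) j @[j --> \oo] --> I01_val (x n)) ->
  rebuild (J R x) = x.
Proof.
move=> x_inj x_cvg.
apply: functional_extensionality_dep => n; apply: I01_val_inj => /=.
have fx : relative_frequency (J R x) n j @[j --> \oo] --> I01_val (x n).
  apply: cvg_trans (x_cvg n); apply: near_eq_cvg; near=> j.
  have nj : (n < 2 ^ j)%N.
    apply: (@leq_trans (2 ^ n.+1)); first exact: ltnW (ltn_expl _ _).
    by rewrite leq_exp2l//; near: j; exact: nbhs_infty_ge.
  rewrite /relative_frequency /empirical; congr (_%:R / _).
  rewrite -count_le_relative_rank; last by move=> ? ? _ _; exact: x_inj.
  (* The last inserted coordinate has index 2 ^ j - 1, so exactly 2 ^ j coordinates are counted. *)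
  rewrite /count_le (_ : (n + (2 ^ j - n.+1)).+1 = 2 ^ j)%N//.
  by rewrite -addSn subnKC.
have fxE : (relative_frequency (J R x) n j)%:E @[j --> \oo] -->
    (I01_val (x n))%:E.
  by apply: cvg_EFin => //; exact: nearW.
have [_ ->] := cvg_limn_einf_sup fxE.
have /andP[x0 x1] : 0 <= I01_val (x n) <= 1 := svalP (x n).
by rewrite /clip /= (min_idPr x1) (max_idPr x0).
Unshelve. all: by end_near. Qed.

End reconstruction.

(** * The distribution of the ranks *)

Section rank_cylinders.

(** Words are plain lists of naturals, hence countably many and free of dependent types; a word with
    an impossible entry has an empty cylinder. *)
Definition rank_cylinder (l : seq nat) : set frakM :=
  [set t | forall i, (i < size l)%N -> sval (t i) = nth 0%N l i].

Lemma measurable_rank_cylinder l : measurable (rank_cylinder l).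
Proof.
exact: (@measurable_box _ seg (size l)
  (fun i => [set s : seg i | sval s = nth 0%N l i])).
Qed.

Definition rank_sequence (l : seq nat) :=
  forall i, (i < size l)%N -> (1 <= nth 0%N l i <= i.+1)%N.

Lemma rank_cylinder_eq0 l : ~ rank_sequence l -> rank_cylinder l = set0.
Proof.
move=> nl; apply/seteqP; split => // t tl; apply: nl => i il.
by rewrite -(tl i il); exact: (svalP (t i)).
Qed.

(** Cylinders form a tree: when two of them meet, the shorter word is a prefix of the longer. *)
Lemma setI_rank_cylinder k l : (size k <= size l)%N ->
  rank_cylinder k `&` rank_cylinder l !=set0 ->
  rank_cylinder k `&` rank_cylinder l = rank_cylinder l.
Proof.
move=> kl [t [tk tl]]; apply/seteqP; split => [s []//|s sl]; split => // i ik.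
have il := leq_trans ik kl.
by rewrite (sl i il) -(tl i il) (tk i ik).
Qed.

Lemma setI_closed_rank_cylinder : setI_closed (range rank_cylinder).
Proof.
move=> _ _ [k _ <-] [l _ <-].
have [->|/set0P kl0] := eqVneq (rank_cylinder k `&` rank_cylinder l) set0.
  (* The empty set is a cylinder too, since 0 is never a rank. *)
  by exists [:: 0%N] => //; rewrite rank_cylinder_eq0// => /(_ 0%N isT).
have [kl|/ltnW lk] := leqP (size k) (size l).
  by exists l => //; rewrite setI_rank_cylinder.
by exists k => //; rewrite setIC setI_rank_cylinder// setIC.
Qed.

(** A condition on coordinate k is a union of cylinders of words of length k + 1, of which there are
    countably many. *)
Lemma measurable_frakME : @measurable _ frakM = <<s range rank_cylinder >>.
Proof.
apply/seteqP; split; last first.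
  apply: smallest_sub; first exact: sigma_algebra_measurable.
  by move=> _ [l _ <-]; exact: measurable_rank_cylinder.
apply: smallest_sub; first exact: smallest_sigma_algebra.
move=> _ [k _ [A _ <-]].
pose F (l : seq nat) := if asbool (size l = k.+1 /\
  exists2 s : seg k, A s & sval s = nth 0%N l k) then rank_cylinder l else set0.
rewrite (_ : _ `&` _ = \bigcup_l F l).
  apply: (@countable_bigcupT_measurable _
    (g_sigma_algebraType (range rank_cylinder)) (seq nat)) => // l.
  rewrite /F; case: asboolP => _; last exact: measurable0.
  by apply: sub_sigma_algebra; exists l.
rewrite setTI; apply/seteqP; split => t /=.
  move=> At; exists (mkseq (fun i => sval (t i)) k.+1) => //.
  rewrite /F asboolT.
    by move=> i; rewrite size_mkseq => ik; rewrite nth_mkseq.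
  by rewrite size_mkseq; split => //; exists (t k) => //; rewrite nth_mkseq.
move=> [l _]; rewrite /F; case: asboolP => // -[lk [s As sl]] tl.
suff -> : t k = s by [].
by apply: val_inj => /=; rewrite sl tl ?lk.
Qed.

Lemma seg_uniform_set1 (R : realType) k a : (1 <= a <= k.+1)%N ->
  seg_uniform R k [set s | sval s = a] = (k.+1%:R^-1)%:E.
Proof.
move=> ak; pose s : seg k := exist _ a ak.
have -> : [set s : seg k | sval s = a] = [set s].
  by apply/seteqP; split => t /= => [ta|->//]; apply: val_inj.
rewrite /seg_uniform /mscale/= /counting asboolT; last exact: finite_set1.
by rewrite fset_set1 cardfs1 mule1.
Qed.

Lemma uniform_rank_cylinder (R : realType) (mu : probability frakM R) l :
  is_product_measure (seg_uniform R) mu -> rank_sequence l ->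
  mu (rank_cylinder l) = ((size l)`!%:R^-1)%:E.
Proof.
move=> Hmu vl.
pose A i := [set s : seg i | sval s = nth 0%N l i].
apply: etrans (Hmu (size l) A _) _ => //.
rewrite (eq_bigr (fun i : 'I_(size l) => ((i.+1)%:R^-1)%:E)) => [|i _];
  last exact/seg_uniform_set1/vl.
elim: (size l) => [|n IH]; first by rewrite big_ord0 fact0 invr1.
by rewrite big_ord_recr IH/= -EFinM factS natrM invfM mulrC.
Qed.

End rank_cylinders.

(** * The law of the ranks of a uniform sequence *)

Section rank_distribution.
Context (R : realType) (m : probability (Iinf R) R).
Hypothesis Hm : is_product_measure (fun=> lebesgue01 R) m.

Lemma null_not_distinct : m (~` distinct_coordinates R) = 0%E.
Proof.
have mD := measurableC (@measurable_distinct_coordinates R).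
exact: (@measure_negligible _ _ _ m _ mD (ae_distinct Hm)).
Qed.

Lemma measure_setI_distinct (E : set (Iinf R)) : measurable E ->
  m (distinct_coordinates R `&` E) = m E.
Proof.
move=> mE; have mD := @measurable_distinct_coordinates R.
have ED : E `\` distinct_coordinates R `<=` ~` distinct_coordinates R.
  by move=> x [].
have mED := measurableD mE mD; have mDC := measurableC mD.
have m0 : m (E `\` distinct_coordinates R) = 0%E.
  exact: (@subset_measure0 _ _ _ m _ _ mED mDC ED null_not_distinct).
transitivity (m (E `\` distinct_coordinates R) +
              m (E `&` distinct_coordinates R))%E.
  by rewrite m0 add0e setIC.
exact: esym (@measureDI _ _ _ m _ _ mE mD).
Qed.

Definition same_order (x0 : Iinf R) n : set (Iinf R) :=
  [set x | forall i j : 'I_n,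
    (I01_val (x i) < I01_val (x j)) = (I01_val (x0 i) < I01_val (x0 j))].

Lemma measurable_same_order x0 n : measurable (same_order x0 n).
Proof.
rewrite (_ : same_order x0 n = \bigcap_(i : 'I_n) \bigcap_(j : 'I_n)
    [set x | (I01_val (x i) < I01_val (x j)) =
             (I01_val (x0 i) < I01_val (x0 j))]).
  apply: fin_bigcap_measurable => // i _.
  apply: fin_bigcap_measurable => // j _.
  rewrite -[X in measurable X]setTI.
  exact: (measurable_fun_ltr (measurable_coord_val i) (measurable_coord_val j)
    measurableT (Y := [set I01_val (x0 i) < I01_val (x0 j)])).
by apply/seteqP; split => x /= xx0 i; [move=> _ j _|move=> j]; exact: xx0.
Qed.

(** A tie in [x] excludes both strict comparisons in [x], hence in [x0], and so is a tie in [x0]. *)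
Lemma same_order_inj x0 n x : injective x0 -> same_order x0 n x ->
  forall i j : 'I_n, I01_val (x i) = I01_val (x j) -> i = j.
Proof.
move=> x0_inj xx0 i j xij; apply/val_inj/x0_inj/I01_val_inj/le_anti.
by rewrite !leNgt -!xx0 xij ltxx.
Qed.

(** Extension by the identity, so that whole sequences can be reindexed. *)
Definition permute n (s : {perm 'I_n}) (k : nat) : nat :=
  if insub k is Some i then val (s i) else k.

Lemma permuteE n (s : {perm 'I_n}) (i : 'I_n) : permute s i = s i.
Proof. by rewrite /permute valK. Qed.

Lemma permute_inj n (s : {perm 'I_n}) : injective (permute s).
Proof.
move=> a b; have [an|an] := ltnP a n; have [bn|bn] := ltnP b n.
- have -> : a = Ordinal an by []; have -> : b = Ordinal bn by [].
  by rewrite !permuteE => /val_inj/perm_inj ->.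
- have -> : a = Ordinal an by [].
  rewrite permuteE /permute insubN -?leqNgt// => sb.
  by have := ltn_ord (s (Ordinal an)); rewrite sb ltnNge bn.
- have -> : b = Ordinal bn by [].
  rewrite permuteE /permute insubN -?leqNgt// => sb.
  by have := ltn_ord (s (Ordinal bn)); rewrite -sb ltnNge an.
- by rewrite /permute !insubN -?leqNgt.
Qed.

(* A permutation of the coordinates does not change how many of them lie below
   a given value, so the order of the permuted sequence determines the value
   that s moves to each place. *)
Lemma same_order_permute_inj x0 n x (s t : {perm 'I_n}) : injective x0 ->
  same_order x0 n (fun k => x (permute s k)) ->
  same_order x0 n (fun k => x (permute t k)) -> s = t.
Proof.
case: n s t => [|N] s t x0_inj xs xt; first by apply/permP => -[].
have count_perm (u : {perm 'I_N.+1}) i :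
    same_order x0 N.+1 (fun k => x (permute u k)) ->
    count_le x N (u i) = count_le x0 N i.
  move=> xu; rewrite /count_le (reindex_inj (@perm_inj _ u))/=.
  by apply: eq_bigr => j _; rewrite !leNgt -xu !permuteE.
apply/permP => i.
have leN (u : {perm 'I_N.+1}) : (u i <= N)%N.
  by have := ltn_ord (u i); rewrite ltnS.
have xst : I01_val (x (s i)) = I01_val (x (t i)).
  apply/le_anti; rewrite !leNgt -(ltn_count_le x (s i) (leN t)).
  by rewrite -(ltn_count_le x (t i) (leN s)) !count_perm// ltnn.
(* Writing both indices as values of [s] turns the tie into one inside the sequence permuted by [s],
   to which [same_order_inj] applies. *)
have -> : t i = s ((s^-1)%g (t i)) by rewrite permKV.
congr (s _); apply: (same_order_inj x0_inj xs).
by rewrite !permuteE permKV.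
Qed.

(** The n! permuted copies of the event are disjoint and equally likely, so n! times its mass is at
    most 1. *)
Lemma same_order_le x0 n : injective x0 ->
  (m (same_order x0 n) <= (n`!%:R^-1)%:E)%E.
Proof.
move=> x0_inj.
pose E (k : 'I_#|{perm 'I_n}|) : set (Iinf R) :=
  [set x | same_order x0 n (fun i => x (permute (enum_val k) i))].
have mE k : measurable (E k).
  rewrite -[X in measurable X]setTI.
  apply: (@measurable_fun_seqprod _ (fun=> I01 R) _ (Iinf R)
    (fun (x : Iinf R) i => x (permute (enum_val k) i))) => //.
    by move=> i; exact: (@measurable_fun_coord _ (fun=> I01 R)).
  exact: measurable_same_order.
have tE : trivIset setT E.
  apply/trivIsetP => i j _ _ ij; apply/seteqP; split => // x [xi xj].
  move/eqP: ij; apply; apply: enum_val_inj.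
  exact: same_order_permute_inj xi xj.
have mEE k : m (E k) = m (same_order x0 n).
  apply: (@iid_preimage_comp _ (I01 R) R _ _ Hm) => //.
    exact: permute_inj.
  exact: measurable_same_order.
have mU : (\sum_k m (E k) <= 1)%E.
  rewrite -(measure_bigsetU_ord m xpredT mE tE).
  by apply: probability_le1; exact: bigsetU_measurable.
rewrite -(fineK (fin_num_measure m _ (measurable_same_order x0 n))) in mEE *.
rewrite (eq_bigr _ (fun k _ => mEE k)) in mU.
move: mU; rewrite sumEFin !lee_fin sumr_const card_ord.
have -> : #|{perm 'I_n}| = n`!.
  by rewrite -card_Sn; apply: eq_card => s; rewrite inE.
rewrite -[X in X <= 1 -> _]mulr_natr => mU.
by rewrite -[leRHS]mul1r ler_pdivlMr// ltr0n fact_gt0.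
Qed.

(** Up to a null set the event, if not empty, lies in the [same_order] class of any of its members
    with distinct coordinates. *)
Lemma preimage_rank_cylinder_le l :
  (m (J R @^-1` rank_cylinder l) <= ((size l)`!%:R^-1)%:E)%E.
Proof.
have mJ : measurable (J R @^-1` rank_cylinder l).
  rewrite -[X in measurable X]setTI.
  exact: measurable_J (measurable_rank_cylinder l).
rewrite -measure_setI_distinct//.
have [->|/set0P[x0 [x0_inj x0l]]] :=
    eqVneq (distinct_coordinates R `&` J R @^-1` rank_cylinder l) set0.
  by rewrite measure0 lee_fin invr_ge0.
apply: le_trans (same_order_le (size l) x0_inj).
apply: le_measure; rewrite ?inE.
- by apply: measurableI => //; exact: measurable_distinct_coordinates.
- exact: measurable_same_order.
move=> x [x_inj xl] i j.
apply: (@eq_rank_order _ _ _ (size l)) => //.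
- by move=> a b _ _; exact: x_inj.
- by move=> a b _ _; exact: x0_inj.
- by move=> k kl; apply: val_inj; exact: etrans (xl k kl) (esym (x0l k kl)).
Qed.

(** Induction on the word: a cylinder is the disjoint union of its one-letter extensions, and their
    upper bounds leave no slack. *)
Lemma preimage_rank_cylinder l : rank_sequence l ->
  m (J R @^-1` rank_cylinder l) = ((size l)`!%:R^-1)%:E.
Proof.
elim/last_ind: l => [_|l a IH vl].
  rewrite (_ : _ @^-1` _ = setT); last by apply/seteqP; split.
  by rewrite probability_setT fact0 invr1.
have {}IH : m (J R @^-1` rank_cylinder l) = ((size l)`!%:R^-1)%:E.
  apply: IH => i il; have := vl i; rewrite size_rcons nth_rcons il.
  by apply; exact: ltnW.
set n := size l in IH *.
have /andP[a1 an] : (1 <= a <= n.+1)%N.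
  by have := vl n; rewrite size_rcons nth_rcons ltnn eqxx; exact.
pose F (b : 'I_n.+1) := J R @^-1` rank_cylinder (rcons l b.+1).
have mF b : measurable (F b).
  rewrite -[X in measurable X]setTI.
  exact: measurable_J (measurable_rank_cylinder _).
have FE b x : F b x <-> (J R @^-1` rank_cylinder l) x /\ sval (J R x n) = b.+1.
  split=> [xb|[xl xn] i].
    split=> [i il|].
      by have := xb i; rewrite size_rcons nth_rcons il; apply; exact: ltnW.
    by have := xb n; rewrite size_rcons nth_rcons ltnn eqxx; exact.
  rewrite size_rcons ltnS leq_eqVlt nth_rcons => /predU1P[->|il].
    by rewrite ltnn eqxx.
  by rewrite il; exact: xl.
have tF : trivIset setT F.
  apply/trivIsetP => b c _ _ /eqP bc; apply/seteqP; split => // x.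
  move=> [/FE[_ xb] /FE[_ xc]]; apply: bc; apply: val_inj.
  by move: xb; rewrite xc => -[].
have FU : J R @^-1` rank_cylinder l = \big[setU/set0]_(b < n.+1) F b.
  rewrite -bigcup_seq; apply/seteqP; split => [x xl|x [b _ /FE[]]//].
  have /andP[r1 rn] := rank_bounds x n.
  have rn' : ((rank x n).-1 < n.+1)%N by rewrite prednK.
  exists (Ordinal rn'); first by rewrite /= mem_index_enum.
  by apply/FE; split => //=; rewrite prednK.
(* The n + 1 summands are at most 1 / (n + 1)! and add up to 1 / n!. *)
have sumF : (\sum_(b < n.+1) m (F b) = (n`!%:R^-1)%:E)%E.
  by apply: etrans (esym (measure_bigsetU_ord m xpredT mF tF)) _; rewrite -FU.
pose c : R := (n.+1)`!%:R^-1.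
have Fc b : (m (F b) <= c%:E)%E.
  by have := preimage_rank_cylinder_le (rcons l b.+1); rewrite size_rcons.
pose r b := fine (m (F b)).
have rE b : m (F b) = (r b)%:E by rewrite fineK// fin_num_measure.
have nr : \sum_(b < n.+1) r b = n`!%:R^-1.
  by apply: EFin_inj; rewrite -sumF -sumEFin; apply: eq_bigr => b _.
have rc b : 0 <= c - r b by rewrite subr_ge0 -lee_fin -rE.
have : \sum_(b < n.+1) (c - r b) = 0.
  rewrite sumrB nr sumr_const card_ord -[c *+ _]mulr_natr /c factS natrM invfM.
  by rewrite mulrAC mulVf ?mul1r ?subrr.
move/(psumr_eq0P (fun b _ => rc b)) => r_eq.
have an' : (a.-1 < n.+1)%N by rewrite prednK.
have /eqP := r_eq (Ordinal an') isT; rewrite subr_eq0 => /eqP ra.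
by have := rE (Ordinal an'); rewrite -ra /F/= prednK// size_rcons.
Qed.

(** The two laws agree on the generating pi-system of rank cylinders, those of impossible words
    being empty. *)
Lemma J_measure_preserving (mu : probability frakM R) (C : set frakM) :
  is_product_measure (seg_uniform R) mu -> measurable C ->
  m (J R @^-1` C) = mu C.
Proof.
move=> Hmu mC.
pose mJ := distribution m (mfun_Sub (mem_set (@measurable_J R))).
apply: (@measure_unique _ _ _ (range rank_cylinder) (fun=> setT)
  _ _ _ _ mJ mu) => //.
- exact: measurable_frakME.
- exact: setI_closed_rank_cylinder.
- by move=> _; exists [::] => //; apply/seteqP; split.
- by rewrite bigcup_const.
- move=> _ [l _ <-]; have [vl|nl] := pselect (rank_sequence l).
    apply: etrans (preimage_rank_cylinder vl) _.
    exact/esym/uniform_rank_cylinder.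
  by rewrite rank_cylinder_eq0// !measure0.
- by move=> _; rewrite [X in (X < _)%E](probability_setT mJ) ltry.
Qed.

End rank_distribution.

(** * The isomorphism *)

Section isomorphism.
Context (R : realType) (m : probability (Iinf R) R) (mu : probability frakM R).
Hypothesis Hm : is_product_measure (fun=> lebesgue01 R) m.
Hypothesis Hmu : is_product_measure (seg_uniform R) mu.

Let D' := distinct_coordinates R `&` @interior_coordinates R.

(* J and rebuild are mutually inverse bijections between A and B. *)
Let A : set (Iinf R) := D' `&` [set x | rebuild R (J R x) = x].

Let B : set frakM := rebuild R @^-1` D' `&` [set t | J R (rebuild R t) = t].

Let measurable_D' : measurable D'.
Proof.
apply: measurableI; first exact: measurable_distinct_coordinates.
exact: measurable_interior_coordinates.
Qed.

Let measurable_A : measurable A.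
Proof.
apply: measurableI => //.
rewrite (_ : [set x | _] = \bigcap_n
    [set x | I01_val (rebuild R (J R x) n) == I01_val (x n)]).
  apply: bigcap_measurableType => n _; rewrite -[X in measurable X]setTI.
  apply: (measurable_fun_eqr _ (measurable_coord_val n) measurableT
    (Y := [set true])) => //.
  exact: (measurableT_comp (measurable_coord_val n)
    (measurableT_comp (@measurable_rebuild R) (@measurable_J R))).
apply/seteqP; split => x.
  move=> xE n _; apply/eqP.
  exact: (congr1 (fun z : Iinf R => I01_val (z n)) xE).
move=> xE; apply: functional_extensionality_dep => n.
by apply/I01_val_inj/eqP; exact: (xE n I).
Qed.

Let measurable_B : measurable B.
Proof.
apply: measurableI.
  by rewrite -[X in measurable X]setTI; exact: measurable_rebuild.
rewrite (_ : [set t | _] = \bigcap_n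
    [set t | sval (J R (rebuild R t) n) == sval (t n)]).
  apply: bigcap_measurableType => n _; rewrite -[X in measurable X]setTI.
  apply: (measurable_fun_eqn _ (measurable_sval_coord n) measurableT
    (Y := [set true])) => //.
  exact: (measurableT_comp (measurable_sval_coord n)
    (measurableT_comp (@measurable_J R) (@measurable_rebuild R))).
apply/seteqP; split => t.
  move=> tE n _; apply/eqP.
  exact: (congr1 (fun s : frakM => sval (s n)) tE).
move=> tE; apply: functional_extensionality_dep => n.
by apply/val_inj/eqP; exact: (tE n I).
Qed.

Let null_A : m (~` A) = 0%E.
Proof.
apply: (@measure_negligible _ _ _ m _ (measurableC measurable_A)).
have aeF := ae_filter_ringOfSetsType m.
have := @filterS3 _ _ aeF _ _ _ A _ (ae_distinct Hm) (ae_interior Hm)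
  (ae_empirical Hm).
apply=> x x_inj x01 x_cvg; split; first by [].
exact: rebuild_J.
Qed.

Let J_A x : A x -> B (J R x).
Proof. by move=> [D'x /= xE]; split; rewrite /preimage/= xE. Qed.

Let rebuild_B t : B t -> A (rebuild R t).
Proof. by move=> [D't /= tE]; split => //=; rewrite tE. Qed.

(** [J] maps [A] into [B], so the preimage of the complement of [B] lies in a null set; measure
    preservation carries this over to [mu]. *)
Let null_B : mu (~` B) = 0%E.
Proof.
have mJ C : measurable C -> measurable (J R @^-1` C).
  by move=> mC; rewrite -[X in measurable X]setTI; exact: measurable_J.
rewrite -(J_measure_preserving Hm Hmu (measurableC measurable_B)).
have nBA : J R @^-1` (~` B) `<=` ~` A by move=> x nB Ax; exact/nB/J_A.
exact: (@subset_measure0 _ _ _ m _ _ (mJ _ (measurableC measurable_B))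
  (measurableC measurable_A) nBA null_A).
Qed.

Lemma J_mod0_isomorphism :
  mod0_isomorphism m mu (distinct_coordinates R) (J R).
Proof.
split.
- exact: measurable_distinct_coordinates.
- exact: null_not_distinct.
- exact: measurable_funTS (@measurable_J R).
- move=> C mC; rewrite measure_setI_distinct//.
    exact: J_measure_preserving.
  by rewrite -[X in measurable X]setTI; exact: measurable_J.
- exists A, B; split=> //.
  + by move=> x [[]].
  + split=> [x|x y|t Bt]; first exact: J_A.
      by rewrite !inE => -[_ /= xE] [_ /= yE] xy; rewrite -xE xy.
    by exists (rebuild R t); [exact: rebuild_B|exact: Bt.2].
  + move=> C mC CA.
    (* Since [rebuild] inverts [J] on [A], the image is a preimage under a measurable map. *)
    rewrite (_ : _ @` _ = B `&` rebuild R @^-1` C).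
      apply: measurableI => //.
      by rewrite -[X in measurable X]setTI; exact: measurable_rebuild.
    apply/seteqP; split=> [_ [x Cx <-]|t [Bt Ct]].
      by split; [exact/J_A/CA|rewrite /preimage/= (CA x Cx).2].
    by exists (rebuild R t) => //; exact: Bt.2.
Qed.

(** The image lies in the cylinder without exception, by [eq_order_rank]. Conversely, a point t of
    the cylinder in [B] is the image of [rebuild R t], which has the order [r] by [eq_rank_order];
    the exceptional set is the complement of [B]. *)
Lemma image_weyl_simplex n (x : Iinf R) (r : rel 'I_n) :
  {in [pred i | i < n]%N &, injective x} ->
  (forall i j : 'I_n, (I01_val (x i) < I01_val (x j)) = r i j) ->
  mod0_eq mu
    (J R @` ([set z : Iinf R | weyl_simplex r (fun i => z i)] `&`
             distinct_coordinates R))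
    [set t | forall i, (i < n)%N -> t i = J R x i].
Proof.
move=> x_inj xr; exists (~` B); split => //; first exact: measurableC.
move=> t [[[z [[z01 _ zr] z_inj] <-] nF]|[Ft nE]].
  exfalso; apply: nF => i ni; apply: (@eq_order_rank _ _ _ n) => // j k jn kn.
  by have := zr (Ordinal jn) (Ordinal kn); rewrite -xr.
move=> [[z_inj z01] /= tE]; apply: nE; exists (rebuild R t) => //; split => //.
split => [i|i j /z_inj/val_inj//|i j]; first exact: z01.
rewrite -xr; apply: (@eq_rank_order _ _ _ n) => //.
- by move=> a b _ _; exact: z_inj.
- by move=> a an; rewrite tE; exact: Ft.
Qed.

(** The cylinder has mass 1 / n! > 0 and so cannot lie in the null complement of [B]. This provides
    each element of [tau] with a point that [J] attains. *)
Lemma tau_meets_B n (s : frakM) :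
  exists2 t, B t & forall i, (i < n)%N -> t i = s i.
Proof.
pose l := mkseq (fun i => sval (s i)) n.
have lE i : (i < n)%N -> nth 0%N l i = sval (s i).
  by move=> ni; rewrite nth_mkseq.
have vl : rank_sequence l.
  by move=> i; rewrite size_mkseq => ni; rewrite lE//; exact: (svalP (s i)).
have [lB0|/set0P[t [tl Bt]]] := eqVneq (rank_cylinder l `&` B) set0.
  have := uniform_rank_cylinder Hmu vl.
  have lB : rank_cylinder l `<=` ~` B.
    by move=> t tl Bt; have : set0 t by rewrite -lB0.
  have -> : mu (rank_cylinder l) = 0%E.
    exact: (@subset_measure0 _ _ _ mu _ _ (measurable_rank_cylinder l)
      (measurableC measurable_B) lB null_B).
  move=> /(congr1 fine)/= /eqP; rewrite eq_sym invr_eq0 pnatr_eq0 => /eqP l0.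
  by have := fact_gt0 (size l); rewrite l0.
exists t => // i ni; apply: val_inj => /=.
by rewrite tl ?size_mkseq// lE.
Qed.

Lemma J_maps_eta_tau n :
  maps_partition_mod0 mu (distinct_coordinates R) (J R) (eta R n) (tau n).
Proof.
split=> [_ [r [y [y01 y_inj yr]] ->]|_ [s ->]].
  (* The tail is constant, so only the first n coordinates are distinct; hence the injectivity below
     n in [image_weyl_simplex] and [eq_rank_order]. *)
  pose x : Iinf R := fun k => if insub k is Some i then y i else point.
  have xE (i : 'I_n) : x i = y i by rewrite /x valK.
  exists [set t | forall i, (i < n)%N -> t i = J R x i].
    by exists (J R x).
  apply: image_weyl_simplex => [i j|i j]; last by rewrite !xE.
  rewrite !inE => ni nj; rewrite (xE (Ordinal ni)) (xE (Ordinal nj)).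
  by move/y_inj => [].
have [t [[x_inj x01] /= tE] ts] := tau_meets_B n s.
set x := rebuild R t in x_inj x01 tE.
pose r : rel 'I_n := fun i j => I01_val (x i) < I01_val (x j).
exists [set z : Iinf R | weyl_simplex r (fun i => z i)].
  exists r => //; exists (fun i => x i); split => // i j /x_inj.
  exact: val_inj.
rewrite (_ : [set t | _] = [set t' | forall i, (i < n)%N -> t' i = J R x i]).
  by apply: image_weyl_simplex => // i j _ _; exact: x_inj.
by apply/seteqP; split => t' /= t's i ni; rewrite t's// tE ts.
Qed.

End isomorphism.

Theorem theorem1 (R : realType)
  (m_inf : probability (Iinf R) R) (mu : probability frakM R)
  (Hm : is_product_measure (fun=> lebesgue01 R) m_inf)
  (Hmu : is_product_measure (seg_uniform R) mu) :
  mod0_isomorphism m_inf mu (distinct_coordinates R) (J R) /\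
  forall n : nat, (0 < n)%N ->
    maps_partition_mod0 mu (distinct_coordinates R) (J R)
      (eta R n) (tau n).
Proof.
split; first exact: J_mod0_isomorphism.
by move=> n _; exact: (J_maps_eta_tau Hm Hmu).
Qed.
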